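(* Let $a(n),b(n),c(n)$ be real polynomials in $n$ of the same degree $\delta$ with positive leading coefficients, taking positive values for all integers $n\ge1$, and let $(u_n)_{n\ge0}$ be a real sequence satisfying $$a(n)u_{n+1}=b(n)u_n-c(n)u_{n-1},\qquad n=1,2,\ldots.$$ For $n\ge 0$ let $Q_n(\lambda)=a(n)\lambda^2-b(n)\lambda+c(n)$. Let $m\ge0$ be an integer and suppose there exists a positive number $\lambda_0$ such that $Q_n(\lambda_0)\le 0$ for all $n\ge m$ and $u_{m+1}\ge\lambda_0u_m>0$. Then $u_n>0$ for all $n\ge m$. *)

(* Defs.v *)
From mathcomp Require Import all_boot all_order all_algebra.
From mathcomp Require Import reals.

Set Implicit Arguments.
Unset Strict Implicit.
Unset Printing Implicit Defensive.

Import Order.TTheory GRing.Theory Num.Theory.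

Local Open Scope ring_scope.

Definition charpolyQ (R : realType) (a b c : {poly R}) (n : nat) (lambda : R)
    : R :=
  a.[n%:R] * lambda ^+ 2 - b.[n%:R] * lambda + c.[n%:R].

(* Main.v *)
Require Import Defs.
From mathcomp Require Import all_boot all_order all_algebra.
From mathcomp Require Import reals ring.

Set Implicit Arguments.
Unset Strict Implicit.
Unset Printing Implicit Defensive.

Import Order.TTheory GRing.Theory Num.Theory.

Local Open Scope ring_scope.

(** The ratio bound [u (n+1) >= l * u n > 0] propagates: eliminating
    [u (n+2)] with the recurrence gives
    [l a (u (n+2) - l u (n+1)) = c (u (n+1) - l u n) - Q(l) u (n+1)],
    whose right-hand side is nonnegative. *)

Lemma ratio_bound_step (R : realFieldType) (a b c l x y z : R) :
  0 < l -> 0 < a -> 0 < c -> a * l ^+ 2 - b * l + c <= 0 ->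
  a * z = b * y - c * x -> 0 <= y -> l * x <= y -> l * y <= z.
Proof.
move=> l0 a0 c0 Q0 rec y0 xy.
rewrite -subr_ge0 -(pmulr_rge0 _ (mulr_gt0 l0 a0)).
have -> : l * a * (z - l * y)
    = c * (y - l * x) - (a * l ^+ 2 - b * l + c) * y.
  (* Isolating the product [a * z] lets [rec] eliminate [z]. *)
  have -> : l * a * (z - l * y) = l * (a * z) - a * l ^+ 2 * y by ring.
  by rewrite rec; ring.
by rewrite addr_ge0 ?oppr_ge0 ?mulr_le0_ge0 // mulr_ge0 ?subr_ge0 // ltW.
Qed.

Theorem theorem1p4 (R : realType) (delta : nat) (a b c : {poly R})
    (u : nat -> R) (m : nat)
    (deg_a : size a = delta.+1) (deg_b : size b = delta.+1)
    (deg_c : size c = delta.+1)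
    (lead_a : 0 < lead_coef a) (lead_b : 0 < lead_coef b)
    (lead_c : 0 < lead_coef c)
    (pos_a : forall n : nat, (1 <= n)%N -> 0 < a.[n%:R])
    (pos_b : forall n : nat, (1 <= n)%N -> 0 < b.[n%:R])
    (pos_c : forall n : nat, (1 <= n)%N -> 0 < c.[n%:R])
    (rec_u : forall n : nat, (1 <= n)%N ->
       a.[n%:R] * u n.+1 = b.[n%:R] * u n - c.[n%:R] * u n.-1)
    (hlambda : exists lambda0 : R,
       [/\ 0 < lambda0,
           forall n : nat, (m <= n)%N -> charpolyQ a b c n lambda0 <= 0,
           lambda0 * u m <= u m.+1
         & 0 < lambda0 * u m]) :
  forall n : nat, (m <= n)%N -> 0 < u n.
Proof.
case: hlambda => l [l0 Q0 le_m um].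
(* Positivity alone does not propagate, as the recurrence subtracts a positive multiple of the
   earlier term; the ratio bound carried along supplies it. *)
have inv n : (m <= n)%N -> 0 < u n /\ l * u n <= u n.+1.
  elim: n => [|n IHn]; rewrite leq_eqVlt => /predU1P[<- | //].
  (* The base index [m] arises twice, as zero and as a successor; [0 < u m] follows from [um] by
     cancelling [l]. *)
  - by rewrite -(pmulr_rgt0 _ l0).
  - by rewrite -(pmulr_rgt0 _ l0).
  rewrite ltnS => le_mn; have [un le_n] := IHn le_mn.
  have un1 : 0 < u n.+1 by apply: lt_le_trans le_n; apply: mulr_gt0.
  (* The recurrence is used at [n.+1], hence at an index at least 1 even when [m = 0]. *)
  split=> //; apply: (ratio_bound_step l0 _ _ (Q0 n.+1 _) (rec_u n.+1 _)) => //.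
  - exact: pos_a.
  - exact: pos_c.
  - exact: leqW.
  - exact: ltW.
by move=> n /inv[].
Qed.
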